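(* Let $\alpha$ be any generator on $\mathbb{R}$ and let $X$ be any non-empty set. (1) If $d^{\alpha}: X\times X\to\mathbb{R}_{\alpha}$ is a non-Newtonian metric on $X$ (with respect to $\alpha$), then $d=\alpha^{-1}\circ d^{\alpha}$ is a metric on $X$. (2) If $d$ is a metric on $X$, then $d^{\alpha}=\alpha\circ d$ is a non-Newtonian metric on $X$ (with respect to $\alpha$).
   Context: A generator $\alpha$ on $\mathbb{R}$ is a one-to-one function whose domain is all of $\mathbb{R}$ and whose range $\mathbb{R}_{\alpha}=\{\alpha(u):u\in\mathbb{R}\}$ is a subset of $\mathbb{R}$; $\alpha^{-1}:\mathbb{R}_{\alpha}\to\mathbb{R}$ denotes its inverse. The $\alpha$-arithmetic on $\mathbb{R}_\alpha$ is defined, for $x,y\in\mathbb{R}_\alpha$, by $x\,\dot{+}\,y=\alpha(\alpha^{-1}(x)+\alpha^{-1}(y))$, $x\,\dot{-}\,y=\alpha(\alpha^{-1}(x)-\alpha^{-1}(y))$, $x\,\dot{\times}\,y=\alpha(\alpha^{-1}(x)\times\alpha^{-1}(y))$, $x\,\dot{/}\,y=\alpha(\alpha^{-1}(x)\div\alpha^{-1}(y))$ (when $\alpha^{-1}(y)\neq 0$), and the order is defined by $x\,\dot{<}\,y\Leftrightarrow\alpha^{-1}(x)<\alpha^{-1}(y)$ (so $x\,\dot{\leq}\,y\Leftrightarrow\alpha^{-1}(x)\leq\alpha^{-1}(y)$). Write $\dot{0}=\alpha(0)$. A map $d^{\alpha}:X\times X\to\mathbb{R}_{\alpha}$ on a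 non-empty set $X$ is a non-Newtonian metric if for all $x,y,z\in X$: ($\alpha$m1) $\dot{0}\,\dot{\leq}\,d^{\alpha}(x,y)$, and $d^{\alpha}(x,y)=\dot{0}\Leftrightarrow x=y$; ($\alpha$m2) $d^{\alpha}(x,y)=d^{\alpha}(y,x)$; ($\alpha$m3) $d^{\alpha}(x,y)\,\dot{\leq}\,d^{\alpha}(x,z)\,\dot{+}\,d^{\alpha}(z,y)$. *)

(* Defs.v *)
From Stdlib Require Import Reals FinFun ClassicalEpsilon.
Open Scope R_scope.

Definition is_generator (alpha : R -> R) : Prop := Injective alpha.

Definition Ralpha (alpha : R -> R) : Type := {y : R | exists u : R, alpha u = y}.

(* [alpha] corestricted to its range. *)
Definition to_Ralpha (alpha : R -> R) (u : R) : Ralpha alpha :=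
  exist (fun y : R => exists v : R, alpha v = y) (alpha u)
    (ex_intro (fun v : R => alpha v = alpha u) u eq_refl).

(* A chosen preimage; it is unique, so this is the inverse of [alpha], as soon
   as [alpha] is a generator (see [alpha_inv_to_Ralpha]). *)
Definition alpha_inv (alpha : R -> R) (y : Ralpha alpha) : R :=
  proj1_sig (constructive_indefinite_description
               (fun u : R => alpha u = proj1_sig y) (proj2_sig y)).

Arguments alpha_inv {alpha} y.

Lemma alpha_alpha_inv (alpha : R -> R) (y : Ralpha alpha) :
  alpha (alpha_inv y) = proj1_sig y.
Proof. unfold alpha_inv. apply proj2_sig. Qed.

Lemma alpha_inv_to_Ralpha (alpha : R -> R) (Halpha : is_generator alpha) (u : R) :
  alpha_inv (to_Ralpha alpha u) = u.
Proof. apply Halpha. exact (alpha_alpha_inv alpha (to_Ralpha alpha u)). Qed.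

Definition alpha_zero (alpha : R -> R) : Ralpha alpha := to_Ralpha alpha 0.

Definition alpha_plus {alpha : R -> R} (x y : Ralpha alpha) : Ralpha alpha :=
  to_Ralpha alpha (alpha_inv x + alpha_inv y).

Definition alpha_le {alpha : R -> R} (x y : Ralpha alpha) : Prop :=
  alpha_inv x <= alpha_inv y.

Record is_nonNewtonian_metric (alpha : R -> R) (X : Type)
    (d : X -> X -> Ralpha alpha) : Prop := {
  nnm_pos : forall x y : X, alpha_le (alpha_zero alpha) (d x y);
  nnm_refl : forall x y : X, d x y = alpha_zero alpha <-> x = y;
  nnm_sym : forall x y : X, d x y = d y x;
  nnm_tri : forall x y z : X, alpha_le (d x y) (alpha_plus (d x z) (d z y))
}.

(* The axioms of the standard library's bundled [Metric_Space], as a predicate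
   on a distance function over a given carrier. *)
Record is_metric (X : Type) (d : X -> X -> R) : Prop := {
  metric_pos : forall x y : X, d x y >= 0;
  metric_sym : forall x y : X, d x y = d y x;
  metric_refl : forall x y : X, d x y = 0 <-> x = y;
  metric_tri : forall x y z : X, d x y <= d x z + d z y
}.

Definition Metric_Space_of_metric (X : Type) (d : X -> X -> R)
    (Hd : is_metric X d) : Metric_Space :=
  Build_Metric_Space X d (metric_pos X d Hd) (metric_sym X d Hd)
    (metric_refl X d Hd) (metric_tri X d Hd).

Lemma dist_is_metric (M : Metric_Space) : is_metric (Base M) (dist M).
Proof.
exact (Build_is_metric _ _ (dist_pos M) (dist_sym M) (dist_refl M) (dist_tri M)).
Qed.

(* Main.v *)
Require Import Defs.
From Stdlib Require Import Reals.
Open Scope R_scope.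

(** A generator is a bijection of the reals onto its range, and the order, sum and zero of the range
    are transported along it. Each metric axiom thus corresponds to its counterpart once [alpha_inv]
    and [to_Ralpha] cancel. *)

(* Destructing the range proof down to [eq_refl] exhibits [y] literally as
   [to_Ralpha alpha u], so proof irrelevance is not required. *)
Lemma to_Ralpha_alpha_inv (alpha : R -> R) (Halpha : is_generator alpha)
    (y : Ralpha alpha) : to_Ralpha alpha (alpha_inv y) = y.
Proof.
destruct y as [v [u []]].
change (to_Ralpha alpha (alpha_inv (to_Ralpha alpha u)) = to_Ralpha alpha u).
now rewrite alpha_inv_to_Ralpha.
Qed.

(** Transfers the axiom on zero distance in both directions; only here is cancellation on the range
    side used. *)
Lemma alpha_inv_eq_0 (alpha : R -> R) (Halpha : is_generator alpha)
    (y : Ralpha alpha) : alpha_inv y = 0 <-> y = alpha_zero alpha.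
Proof.
split; intros H.
- rewrite <- (to_Ralpha_alpha_inv alpha Halpha y), H. reflexivity.
- rewrite H. now apply alpha_inv_to_Ralpha.
Qed.

Theorem theorem2p2 (alpha : R -> R) (Halpha : is_generator alpha)
    (X : Type) (HX : inhabited X) :
  (forall dalpha : X -> X -> Ralpha alpha,
     is_nonNewtonian_metric alpha X dalpha ->
     is_metric X (fun x y : X => alpha_inv (dalpha x y))) /\
  (forall d : X -> X -> R,
     is_metric X d ->
     is_nonNewtonian_metric alpha X (fun x y : X => to_Ralpha alpha (d x y))).
Proof.
split.
- intros dalpha [Hpos Hrefl Hsym Htri].
  unfold alpha_le, alpha_plus, alpha_zero in Hpos, Htri.
  split; intros x y.
  + apply Rle_ge. rewrite <- (alpha_inv_to_Ralpha alpha Halpha 0). apply Hpos.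
  + now rewrite Hsym.
  + rewrite alpha_inv_eq_0 by exact Halpha. apply Hrefl.
  + intros z. specialize (Htri x y z).
    now rewrite (alpha_inv_to_Ralpha alpha Halpha) in Htri.
- intros d [Hpos Hsym Hrefl Htri].
  split; intros x y.
  + unfold alpha_le, alpha_zero. rewrite !alpha_inv_to_Ralpha by exact Halpha.
    apply Rge_le, Hpos.
  (* Pulling the equation back along [alpha_inv] reduces it to [d x y = 0]. *)
  + rewrite <- (alpha_inv_eq_0 alpha Halpha), alpha_inv_to_Ralpha by exact Halpha.
    apply Hrefl.
  + now rewrite Hsym.
  + intros z. unfold alpha_le, alpha_plus.
    rewrite !alpha_inv_to_Ralpha by exact Halpha. apply Htri.
Qed.
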